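(* Let $G$ be a connected finite simple graph on $n$ vertices, let $1\le k\le n-1$ be an integer, let $S=\{x,y\}$ be a 2-cut with the same neighbours of $G$, and let $\alpha\subseteq T_S$. Then the map $\varphi_{S,\alpha}$ is an automorphism of $F_k(G)$. Moreover, $\varphi_{S,\alpha}$ is an induced automorphism of $F_k(G)$ if and only if $\alpha=\emptyset$ or $\alpha=T_S$.
   Context: The $k$-token graph $F_k(G)$ is the graph whose vertices are all $k$-subsets of $V(G)$, where $A$ and $B$ are adjacent whenever their symmetric difference $A\triangle B$ is an edge of $G$ (i.e. a pair of adjacent vertices of $G$). For $f\in\operatorname{Aut}(G)$, let $\iota(f)\in\operatorname{Aut}(F_k(G))$ be given by $\iota(f)(\{a_1,\dots,a_k\})=\{f(a_1),\dots,f(a_k)\}$. When $k=n/2$, the complement automorphism $\mathfrak{c}\in \operatorname{Aut}(F_k(G))$ is given by $\mathfrak{c}(A)=V(G)\setminus A$. An automorphism $g$ of $F_k(G)$ is called induced if there exists $f\in\operatorname{Aut}(G)$ such that $g=\iota(f)$ or (when $k=n/2$) $g=\mathfrak{c}\circ\iota(f)$. A 2-cut with the same neighbours of $G$ is a set $S=\{x,y\}$ of two distinct vertices of $G$ such that $S$ is a cut set of $G$ (that is, $G\setminus S$ is disconnected) and $x$ and $y$ have the same neighbours in $V(G)\setminus S$. Let $G_1,\dots,G_{c_S}$ be the connected components of $G\setminus S$ in some fixed order, and let $n_i=|V(G_i)|$. Define \[T_S:=\Big\{(k_1,\dots,k_{c_S}) : k_i\in\mathbb{Z},\ 0\le k_i\le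 n_i \text{ for every } i,\ \sum_{i=1}^{c_S}k_i=k-1\Big\}.\] For $t\in T_S$, with $i$-th coordinate $t(i)$, let \[V_{S,t}:=\{A\in V(F_k(G)) : |A\cap V(G_i)|=t(i)\text{ for every }1\le i\le c_S\};\] thus every $A\in V_{S,t}$ satisfies $|A\cap S|=1$. For $A$ with $|A\cap S|=1$ let $A^S:=(A\setminus S)\cup(S\setminus A)$. For $\alpha\subseteq T_S$, the map $\varphi_{S,\alpha}:V(F_k(G))\to V(F_k(G))$ is defined by $\varphi_{S,\alpha}(A):=A^S$ if there exists $t\in\alpha$ such that $A\in V_{S,t}$, and $\varphi_{S,\alpha}(A):=A$ otherwise. *)

(* Defs.v *)
From HB Require Import structures.
From mathcomp Require Import all_boot.
From mathcomp Require Import perm.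

Set Implicit Arguments.
Unset Strict Implicit.
Unset Printing Implicit Defensive.

Record sgraph := SGraph {
  vertex :> finType;
  adj : rel vertex;
  adj_sym : symmetric adj;
  adj_irr : irreflexive adj
}.
Arguments adj {s}.
Arguments SGraph {vertex adj}.

Section Connectivity.
Variable G : sgraph.
Implicit Types (U S : {set G}).

(* Reachability in the subgraph of [G] induced by [U]; the graph [G \ S] is
   handled as the subgraph induced by [~: S]. *)
Definition joined U : rel G :=
  connect [rel u v : G | [&& u \in U, v \in U & adj u v]].

Definition connected_on U := [forall u in U, forall v in U, joined U u v].

Definition connected := (0 < #|G|) && connected_on [set: G].

Definition components U : {set {set G}} := equivalence_partition (joined U) U.

Definition cut_set S := ~~ connected_on (~: S).

Definition two_cut_same_neighbours (x y : G) :=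
  [/\ x != y, cut_set [set x; y] &
      forall z, z \notin [set x; y] -> adj x z = adj y z].

(* [C] lists the connected components of the subgraph induced by [U], each
   exactly once, in an arbitrary order. *)
Definition component_listing U c (C : 'I_c -> {set G}) :=
  injective C /\ [set C i | i : 'I_c] = components U.

Definition automorphism (f : G -> G) :=
  bijective f /\ forall u v, adj (f u) (f v) = adj u v.

End Connectivity.

Section TokenGraph.
Variables (G : sgraph) (k : nat).

Definition symdiff (A B : {set G}) := (A :\: B) :|: (B :\: A).

Definition token := {A : {set G} | #|A| == k}.

Definition token_adj : rel token := fun A B =>
  [exists u : G, exists v : G,
     adj u v && (symdiff (val A) (val B) == [set u; v])].

Lemma token_adj_sym : symmetric token_adj.
Proof. by move=> A B; rewrite /token_adj /symdiff setUC. Qed.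

Lemma token_adj_irr : irreflexive token_adj.
Proof.
move=> A; apply/existsP => -[u /existsP[v /andP[_ /eqP/setP/(_ u)]]].
by rewrite /symdiff setDv setU0 !inE eqxx.
Qed.

Definition token_graph : sgraph := SGraph token_adj_sym token_adj_irr.

Lemma token_map_subproof (f : {perm G}) (A : token) : #|f @: val A| == k.
Proof. by rewrite (card_imset _ perm_inj) (valP A). Qed.

Definition token_map (f : {perm G}) (A : token) : token :=
  exist _ (f @: val A) (token_map_subproof f A).

Lemma complement_subproof (nk : #|G| = k.*2) (A : token) : #|~: val A| == k.
Proof. by rewrite cardsCs setCK nk (eqP (valP A)) -addnn addnK. Qed.

Definition complement (nk : #|G| = k.*2) (A : token) : token :=
  exist _ (~: val A) (complement_subproof nk A).

Definition induced_automorphism (g : token_graph -> token_graph) :=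
  automorphism g /\
  exists2 f : {perm G}, automorphism f &
    g =1 token_map f \/ exists nk : #|G| = k.*2, g =1 complement nk \o token_map f.

End TokenGraph.

Section SwapMap.
Variables (G : sgraph) (k c : nat) (C : 'I_c -> {set G}).

(* The integers [k_i] satisfy [0 <= k_i <= n_i <= #|G|], so the tuples
   [(k_1, ..., k_c)] are taken in this finite type. *)
Definition profile := {ffun 'I_c -> 'I_#|G|.+1}.

(* [\sum_i k_i = k - 1] is written without truncated subtraction. *)
Definition profiles : {set profile} :=
  [set t : profile | [forall i, t i <= #|C i|] && ((\sum_i t i).+1 == k)].

Definition profile_class (t : profile) : {set token_graph G k} :=
  [set A | [forall i, #|val A :&: C i| == t i]].

(* The swap [A^S = (A \ S) U (S \ A)]. The default value [A] of [insubd] only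
   serves to make the map total: see [val_swap] and [profile_class_swap]. *)
Definition swap (S : {set G}) (A : token_graph G k) : token_graph G k :=
  insubd A (symdiff (val A) S).

Definition phi (S : {set G}) (alpha : {set profile}) (A : token_graph G k) :=
  if [exists t in alpha, A \in profile_class t] then swap S A else A.

Lemma val_swap (S : {set G}) (A : token_graph G k) :
  #|S| = 2 -> #|val A :&: S| = 1 -> val (swap S A) = symdiff (val A) S.
Proof.
move=> S2 AS1; rewrite val_insubd ifT // /symdiff cardsU.
rewrite (_ : (_ :\: _) :&: (_ :\: _) = set0) ?cards0 ?subn0; last first.
  by apply/setP=> z; rewrite !inE; case: (z \in S); case: (z \in val A).
have A1 := cardsID S (val A); have A2 := cardsID (val A) S.
rewrite setIC AS1 S2 in A2; rewrite AS1 (eqP (valP A)) in A1.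
by rewrite (@addnI 1 _ 1 A2) addnC A1.
Qed.

Lemma profile_class_swap (S : {set G}) (t : profile) (A : token_graph G k) :
  component_listing (~: S) C -> t \in profiles -> A \in profile_class t ->
  #|val A :&: S| = 1.
Proof.
rewrite /component_listing /components => -[injC imC]; rewrite !inE => /andP[_ /eqP sum_t] /forallP At.
have eqR : {in ~: S & &, equivalence_rel (joined (~: S))}.
  have symj : connect_sym
      [rel u v : G | [&& u \in ~: S, v \in ~: S & adj u v]].
    by apply: sym_connect_sym => u v /=; rewrite adj_sym andbCA.
  by move=> u v w _ _ _; split=> [|uv]; [exact: connect0
    | exact: (same_connect symj uv)].
have /and3P[/eqP covC trivC _] := equivalence_partitionP eqR.
rewrite -imC cover_imset in covC; rewrite -imC in trivC.
have cardD : #|val A :\: S| = \sum_i t i.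
  have disjC i j : i != j -> [disjoint C i & C j].
    move=> nij; have /trivIsetP := trivC; apply.
    - exact: imset_f.
    - exact: imset_f.
    - by rewrite (inj_eq injC).
  have -> : val A :\: S = \bigcup_i (val A :&: C i).
    by rewrite -big_distrr /= setDE -covC.
  rewrite -sum1_card partition_disjoint_bigcup => [|i j /disjC].
    by apply: eq_bigr => i _; rewrite sum1_card (eqP (At i)).
  by apply: disjointW; apply: subsetIr.
have := cardsID S (val A); rewrite cardD => cardA.
by apply/eqP; rewrite -(eqn_add2r (\sum_i t i)) cardA add1n sum_t (valP A).
Qed.

End SwapMap.

(* Main.v *)
(** Adjacent vertices of [F_k(G)] with different profiles differ by an edge
    with exactly one end in [S]; swapping only one of the two replaces that end
    by its twin, which gives an edge again.  If [A] contains [x] but not [y],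
    then [A] minus its swap is [{x}], so a permutation [f] inducing [phi] is
    determined at [x] by what [phi] does on a single class: [f x = y] on a
    swapped class and [f x = x] on a fixed one, the other way round if [phi]
    is composed with the complement. *)
Require Import Defs.
From mathcomp Require Import all_boot.
From mathcomp Require Import perm.

Set Implicit Arguments.
Unset Strict Implicit.
Unset Printing Implicit Defensive.

(** * Components of an induced subgraph *)

Section Components.
Variable G : sgraph.
Implicit Types U : {set G}.

Lemma joined_sym U : connect_sym [rel u v : G | [&& u \in U, v \in U & adj u v]].
Proof. by apply: sym_connect_sym => u v /=; rewrite adj_sym andbCA. Qed.

Lemma joined_equiv U : {in U & &, equivalence_rel (joined U)}.
Proof.
move=> u v w _ _ _; split=> [|uv]; first exact: connect0.
exact: (same_connect (joined_sym U) uv).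
Qed.

Variables (U : {set G}) (c : nat) (C : 'I_c -> {set G}).
Hypothesis listC : component_listing U C.

Lemma listing_partition : partition [set C i | i : 'I_c] U.
Proof. by rewrite listC.2; apply/equivalence_partitionP/joined_equiv. Qed.

Lemma listing_disjoint i j : i != j -> [disjoint C i & C j].
Proof.
move=> neq_ij; have /and3P[_ /trivIsetP trivC _] := listing_partition.
by apply: trivC; rewrite ?imset_f // (inj_eq listC.1).
Qed.

Lemma listing_cover : \bigcup_i C i = U.
Proof. by have /and3P[/eqP <- _ _] := listing_partition; rewrite cover_imset. Qed.

Lemma listing_sub i : C i \subset U.
Proof. by rewrite -listing_cover bigcup_sup. Qed.

Lemma listing_card (A : {set G}) : \sum_i #|A :&: C i| = #|A :&: U|.
Proof.
rewrite -listing_cover big_distrr /= -sum1_card partition_disjoint_bigcup => [|i j neq_ij].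
  by apply: eq_bigr => i _; rewrite sum1_card.
apply: disjointW (listing_disjoint neq_ij); exact: subsetIr.
Qed.

(** A component is the class of some [w] under [joined U], an equivalence relation for which an edge
    inside [U] makes its ends equivalent. *)
Lemma listing_adj u v i : u \in U -> v \in U -> adj u v ->
  (u \in C i) = (v \in C i).
Proof.
move=> uU vU uv; have : C i \in components U by rewrite -listC.2 imset_f.
case/imsetP=> w wU ->; rewrite !inE uU vU /=.
have juv : joined U u v by apply: connect1; rewrite /= uU vU.
by rewrite /joined !(joined_sym U w) (same_connect (joined_sym U) juv).
Qed.

End Components.

Lemma ex_subset_card (T : finType) (D : {set T}) m :
  m <= #|D| -> exists2 E : {set T}, E \subset D & #|E| = m.
Proof.
move=> le_m; exists [set z in take m (enum D)].
  by apply/subsetP=> z; rewrite inE => /mem_take; rewrite mem_enum.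
rewrite cardsE (card_uniqP _) ?take_uniq ?enum_uniq // size_take_min.
by rewrite -cardE; apply/minn_idPl.
Qed.

(** * Symmetric differences and edges of the token graph *)

Section Token.
Variables (G : sgraph) (k : nat).
Implicit Types A B : token_graph G k.

Lemma in_symdiff (X Y : {set G}) z :
  (z \in symdiff X Y) = (z \in X) (+) (z \in Y).
Proof. by rewrite !inE; case: (z \in X); case: (z \in Y). Qed.

Lemma symdiffK (X Y : {set G}) : symdiff (symdiff X Y) Y = X.
Proof. by apply/setP=> z; rewrite !in_symdiff addbK. Qed.

Lemma symdiffACA (X Y Z : {set G}) :
  symdiff (symdiff X Z) (symdiff Y Z) = symdiff X Y.
Proof. by apply/setP=> z; rewrite !in_symdiff addbACA addbb addbF. Qed.

Lemma symdiffAC (X Y Z : {set G}) :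
  symdiff (symdiff X Z) Y = symdiff (symdiff X Y) Z.
Proof. by apply/setP=> z; rewrite !in_symdiff addbAC. Qed.

Lemma token_adjP A B :
  reflect (exists u v, adj u v /\ symdiff (val A) (val B) = [set u; v])
          (adj A B).
Proof.
apply: (iffP existsP) => [[u /existsP[v /andP[uv /eqP AB]]]|[u [v [uv AB]]]].
  by exists u, v.
by exists u; apply/existsP; exists v; rewrite uv AB eqxx.
Qed.

(** Both sets have [k] elements, so the two differences have equal size; together they have two
    elements, hence one each. *)
Lemma token_adj_move A B : adj A B ->
  exists u v, [/\ adj u v, val A :\: val B = [set u] & val B :\: val A = [set v]].
Proof.
case/token_adjP=> u [v [uv AB]].
have neq_uv : u != v by apply: contraTneq uv => ->; rewrite adj_irr.
have eqD : #|val A :\: val B| = #|val B :\: val A|.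
  apply/eqP; rewrite -(eqn_add2l #|val A :&: val B|) cardsID setIC cardsID.
  by rewrite (eqP (valP A)) (eqP (valP B)).
have card2 : #|val A :\: val B| + #|val B :\: val A| = 2.
  have := congr1 (fun X : {set G} => #|X|) AB.
  rewrite cards2 neq_uv cardsU (_ : _ :&: _ = set0) ?cards0 ?subn0 //.
  by apply/setP=> z; rewrite !inE; case: (z \in val A); case: (z \in val B).
have card1 : #|val A :\: val B| = 1.
  by apply: double_inj; rewrite -addnn {2}eqD.
have /eqP/cards1P[a Ea] := card1; rewrite eqD in card1.
have /eqP/cards1P[b Eb] := card1.
exists a, b; split=> //.
rewrite /symdiff Ea Eb in AB; move/setP: AB => AB.
(* Of the four ways to match [u], [v] with [a], [b], two would give [u = v]; the other two give the
   edge or its reverse. *)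
have := AB u; have := AB v; rewrite !inE !eqxx orbT /=.
case/orP=> /eqP ev /orP[] /eqP eu; move: uv; rewrite -?ev -?eu //.
- by rewrite eu ev eqxx in neq_uv.
- by rewrite adj_sym.
- by rewrite eu ev eqxx in neq_uv.
Qed.

End Token.

Lemma involutive_automorphism (G : sgraph) (g : G -> G) :
  involutive g -> (forall u v, adj u v -> adj (g u) (g v)) -> automorphism g.
Proof.
move=> gK g_adj; split=> [|u v]; first by exists g.
by apply/idP/idP=> [/g_adj|]; [rewrite !gK | exact: g_adj].
Qed.

(** * Profiles and the effect of a swap on them *)

Section Swap.
Variables (G : sgraph) (k c : nat) (C : 'I_c -> {set G}) (x y : G).
Notation S := [set x; y].
Hypotheses (listC : component_listing (~: S) C) (neq_xy : x != y).
Implicit Types (A B : token_graph G k) (t : profile G c).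
Implicit Type alpha : {set profile G c}.

(** Defined for every token set, so that membership in a class becomes an equality. The bound in
    [inord] is never exceeded, since a set of vertices has at most [#|G|] elements. *)
Definition profile_of A : profile G c := [ffun i => inord #|val A :&: C i|].

Lemma profile_ofE A i : profile_of A i = #|val A :&: C i| :> nat.
Proof. by rewrite ffunE inordK // ltnS max_card. Qed.

Lemma in_profile_class t A : (A \in profile_class k C t) = (profile_of A == t).
Proof.
rewrite inE; apply/forallP/eqP => [At|<- i]; last by rewrite profile_ofE.
by apply/ffunP=> i; apply: val_inj; rewrite /= profile_ofE (eqP (At i)).
Qed.

Lemma phiE alpha A :
  phi C S alpha A = if profile_of A \in alpha then swap S A else A.
Proof.
rewrite /phi; congr (if _ then _ else _); apply/existsP/idP => [[t]|pA].
  by rewrite in_profile_class => /andP[t_alpha /eqP->].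
by exists (profile_of A); rewrite pA in_profile_class eqxx.
Qed.

Lemma cards_pair : #|S| = 2. Proof. by rewrite cards2 neq_xy. Qed.

(** The components partition [~: S], so the entries of the profile sum to [k] minus the size of
    [val A :&: S]. *)
Lemma profiles_profile_of A :
  (profile_of A \in profiles k C) = (#|val A :&: S| == 1).
Proof.
rewrite inE; have -> : [forall i, profile_of A i <= #|C i|].
  by apply/forallP=> i; rewrite profile_ofE subset_leq_card ?subsetIr.
rewrite (eq_bigr _ (fun i _ => profile_ofE A i)) (listing_card listC) -setDE.
have kA : #|val A :&: S| + #|val A :\: S| = k by rewrite cardsID (eqP (valP A)).
by rewrite -[X in _ == X]kA -add1n eqn_add2r eq_sym.
Qed.

(** The default value of [swap] never arises: a profile in [alpha] forces [val A] to meet [S] in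
    exactly one vertex. *)
Lemma val_phi alpha A : alpha \subset profiles k C ->
  val (phi C S alpha A)
    = if profile_of A \in alpha then symdiff (val A) S else val A.
Proof.
move=> /subsetP sub_alpha; rewrite phiE; case: ifP => // /sub_alpha.
by rewrite profiles_profile_of => /eqP AS1; rewrite val_swap ?cards_pair.
Qed.

Lemma listing_notinS i z : z \in C i -> z \notin S.
Proof. by move/(subsetP (listing_sub listC i)); rewrite in_setC. Qed.

Lemma profile_of_phi alpha A : alpha \subset profiles k C ->
  profile_of (phi C S alpha A) = profile_of A.
Proof.
move=> sub_alpha; apply/ffunP=> i; apply: val_inj; rewrite /= !profile_ofE.
rewrite val_phi //; case: ifP => // _; congr #|pred_of_set _|.
apply/setP=> z; rewrite !(in_setI, in_symdiff).
by have [/listing_notinS/negPf->|] := boolP (z \in C i); rewrite ?addbF ?andbF.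
Qed.

Lemma phiK alpha : alpha \subset profiles k C ->
  involutive (phi (k := k) C S alpha).
Proof.
move=> sub_alpha A; apply: val_inj.
rewrite !val_phi // profile_of_phi //.
by case: (profile_of A \in alpha) => //=; rewrite symdiffK.
Qed.

(** The moved token stays either inside [S] or outside it; in the latter case the edge keeps it in
    one component, so no count changes. *)
Lemma profile_of_adj A B u v : adj u v -> (u \in S) = (v \in S) ->
  val A :\: val B = [set u] -> val B :\: val A = [set v] ->
  profile_of A = profile_of B.
Proof.
move=> uv uvS AB BA; apply/ffunP=> i; apply: val_inj; rewrite /= !profile_ofE.
have uvC : (u \in C i) = (v \in C i).
  have [uS|uS] := boolP (u \in S); last first.
    by apply: (listing_adj listC) uv; rewrite in_setC -?uvS.
  by apply/idP/idP=> /listing_notinS; rewrite ?uS // -uvS uS.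
have card1 w : #|[set w] :&: C i| = (w \in C i).
  rewrite -sum1_card big_mkcond /= (bigD1 w) //= big1 => [|z /negPf nzw].
    by rewrite !inE eqxx addn0; case: (w \in C i).
  by rewrite !inE nzw.
(* Each count is split into the part common to [A] and [B] and the contribution of the single moved
   vertex. *)
have split (X Y : {set G}) :
    #|X :&: C i| = #|X :&: Y :&: C i| + #|(X :\: Y) :&: C i|.
  by rewrite -(cardsID Y (X :&: C i)) setIAC setIDAC.
by rewrite (split (val A) (val B)) (split (val B) (val A)) AB BA !card1 uvC
  [val A :&: val B]setIC.
Qed.

(** * Twin vertices: every swap map is an automorphism *)

Hypothesis twins : forall z, z \notin S -> adj x z = adj y z.

Lemma twin_symdiff_edge u v : adj u v -> u \in S -> v \notin S ->
  exists u' v', adj u' v' /\ symdiff [set u; v] S = [set u'; v'].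
Proof.
(* The new edge keeps [v] and takes the other vertex of [S] in place of [u]. *)
move=> uv uS vS; have := vS; rewrite !inE negb_or => /andP[nvx nvy].
case/set2P: uS uv => -> uv; [exists y, v | exists x, v];
  (split; first by [rewrite -twins | rewrite twins]); apply/setP=> z;
  rewrite in_symdiff !inE;
  have [->|nzx] := eqVneq z x; rewrite ?(negPf neq_xy) ?(eq_sym x v) ?(negPf nvx) //=;
  have [->|nzy] := eqVneq z y;
    rewrite ?(eq_sym y x) ?(negPf neq_xy) ?(eq_sym y v) ?(negPf nvy) ?addbF //=.
Qed.

Lemma phi_adj_mixed alpha A B : alpha \subset profiles k C ->
  profile_of A \in alpha -> profile_of B \notin alpha -> adj A B ->
  adj (phi C S alpha A) (phi C S alpha B).
Proof.
move=> sub_alpha pA pB /token_adj_move[u [v [uv AB BA]]]; apply/token_adjP.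
rewrite !val_phi // pA (negPf pB) symdiffAC.
rewrite (_ : symdiff (val A) _ = [set u; v]); last by rewrite /symdiff AB BA.
have [uS|uS] := boolP (u \in S); have [vS|vS] := boolP (v \in S).
- by rewrite -(profile_of_adj uv _ AB BA) ?uS ?pA in pB.
- exact: twin_symdiff_edge.
- by rewrite setUC; apply: twin_symdiff_edge; rewrite 1?adj_sym.
- by rewrite -(profile_of_adj uv _ AB BA) ?(negPf uS) ?(negPf vS) ?pA in pB.
Qed.

Lemma phi_automorphism alpha : alpha \subset profiles k C ->
  automorphism (phi (k := k) C S alpha).
Proof.
move=> sub_alpha; apply: involutive_automorphism (phiK sub_alpha) _ => A B AB.
have [pA|pA] := boolP (profile_of A \in alpha);
have [pB|pB] := boolP (profile_of B \in alpha).
(* When both ends are swapped, the two copies of [S] cancel in the symmetric difference. *)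
- apply/token_adjP; rewrite !val_phi // pA pB symdiffACA; exact/token_adjP.
- exact: phi_adj_mixed.
- by rewrite adj_sym; apply: phi_adj_mixed; rewrite 1?adj_sym.
- apply/token_adjP; rewrite !val_phi // (negPf pA) (negPf pB); exact/token_adjP.
Qed.

(** * Which swap maps are induced *)

Lemma tperm_twins_automorphism : automorphism (tperm x y : G -> G).
Proof.
apply: involutive_automorphism => [|u v uv]; first exact: tpermK.
have twin z : z != x -> z != y -> adj x z = adj y z.
  by move=> zx zy; apply: twins; rewrite !inE negb_or zx.
case: tpermP uv => [->|->|/eqP ux /eqP uy]; case: tpermP => [->|->|/eqP vx /eqP vy] //;
  rewrite ?adj_irr //.
- by rewrite adj_sym.
- by rewrite twin.
- by rewrite adj_sym.
- by rewrite twin.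
- by rewrite adj_sym twin // adj_sym.
- by rewrite adj_sym -twin // adj_sym.
Qed.

(** A set containing both or neither of [x], [y] is fixed by the transposition; one containing a
    single twin trades it for the other. Hence [phi] for the full set of profiles is the action of
    [tperm x y]. *)
Lemma tperm_imset (A : {set G}) :
  tperm x y @: A = if #|A :&: S| == 1 then symdiff A S else A.
Proof.
have memt z : (z \in tperm x y @: A) = (tperm x y z \in A).
  by rewrite -{1}(tpermK x y z) mem_imset //; apply: perm_inj.
have cardS : #|A :&: S| = (x \in A) + (y \in A).
  rewrite setIC -sum1_card big_mkcond /= (bigD1 x) //= (bigD1 y) 1?eq_sym //=.
  rewrite big1 => [|z /andP[/negPf zx /negPf zy]]; last by rewrite !inE zx zy.
  by rewrite !inE !eqxx orbT addn0; case: (x \in A); case: (y \in A).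
rewrite cardS; apply/setP=> z; rewrite memt.
have zS : (z \in S) = (z == x) || (z == y) by rewrite !inE.
case: tpermP => [->|->|/eqP zx /eqP zy].
- by case: ifP; rewrite ?in_symdiff ?set21; case: (x \in A); case: (y \in A).
- by case: ifP; rewrite ?in_symdiff ?set22; case: (x \in A); case: (y \in A).
- by case: ifP; rewrite ?in_symdiff // zS (negPf zx) (negPf zy) addbF.
Qed.

(** Take [t i] vertices from each component [C i] and add [x]; the entries sum to [k - 1], so the
    result has [k] elements. *)
Lemma ex_profile_token t : t \in profiles k C ->
  exists A, [/\ profile_of A = t, x \in val A & y \notin val A].
Proof.
rewrite inE => /andP[/forallP le_t /eqP sum_t].
have [D] : exists D : 'I_c -> {set G},
    forall i, D i \subset C i /\ #|D i| = t i.
  have D_ i : exists E : {set G}, (E \subset C i) && (#|E| == t i).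
    by have [E sE cE] := ex_subset_card (le_t i); exists E; rewrite sE cE eqxx.
  by exists (fun i => xchoose (D_ i)) => i; have /andP[? /eqP] := xchooseP (D_ i).
move=> DP; pose E := \bigcup_i D i.
have EC i : E :&: C i = D i.
  apply/setP=> z; rewrite inE; apply/andP/idP => [[/bigcupP[j _ zj] zi]|zi].
    have [->//|/(listing_disjoint listC)/disjointFr/(_ zi)] := eqVneq i j.
    by rewrite (subsetP (DP j).1 _ zj).
  by split; [apply/bigcupP; exists i | apply: (subsetP (DP i).1)].
have ES z : z \in E -> z \notin S.
  by case/bigcupP=> i _ /(subsetP (DP i).1)/listing_notinS.
have xE : x \notin E by apply/negP=> /ES; rewrite set21.
have cardE : #|E| = \sum_i t i.
  have <- : E :&: ~: S = E.
    by apply/setIidPl/subsetP=> z /ES; rewrite in_setC.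
  by rewrite -(listing_card listC); apply: eq_bigr => i _; rewrite EC (DP i).2.
have cardA : #|x |: E| == k by rewrite cardsU1 xE cardE add1n sum_t.
exists (exist _ (x |: E) cardA : token_graph G k); split=> /=.
- apply/ffunP=> i; apply: val_inj; rewrite /= profile_ofE /= -(DP i).2 -EC.
  congr #|pred_of_set _|; apply/setP=> z; rewrite !inE.
  have [->/=|//] := eqVneq z x.
  by have [/listing_notinS|_] := boolP (x \in C i); rewrite ?set21 ?andbF.
- by rewrite setU11.
- rewrite !inE negb_or eq_sym neq_xy; apply/negP=> /ES.
  by rewrite set22.
Qed.

Lemma separating_token t : t \in profiles k C ->
  exists A B, [/\ profile_of A = t, profile_of B = t,
    val B = symdiff (val A) S, val A :\: val B = [set x] & val B :\: val A = [set y]].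
Proof.
move=> t_prof; have [A [pA xA yA]] := ex_profile_token t_prof.
(* The partner [B] is the image of [A] under the map that swaps the single class of [t]. *)
have sub1 : [set t] \subset profiles k C by rewrite sub1set.
have pA1 : profile_of A \in [set t] by rewrite pA set11.
exists A, (phi C S [set t] A); rewrite profile_of_phi // val_phi // pA1.
split=> //; apply/setP=> z; rewrite in_setD in_symdiff in_set1 !inE.
- have [->|zx] := eqVneq z x; first by rewrite xA.
  by have [->|zy] := eqVneq z y; rewrite ?(negPf yA) ?addbF ?andNb.
- have [->|zx] := eqVneq z x; first by rewrite xA (negPf neq_xy).
  by have [->|zy] := eqVneq z y; rewrite ?(negPf yA) ?addbF ?andNb.
Qed.

(* Common to both kinds of induced automorphisms: [b] records whether the
   complement is taken. *)
Lemma swapped_of_perm alpha (f : {perm G}) (b : bool) t :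
  alpha \subset profiles k C ->
  (forall A, f @: val A
     = if b then ~: val (phi C S alpha A) else val (phi C S alpha A)) ->
  t \in profiles k C -> f x = if b (+) (t \in alpha) then y else x.
Proof.
move=> sub_alpha fP /separating_token[A [B [pA pB BE AB BA]]].
have : f x \in f @: val A :\: f @: val B.
  by rewrite in_setD !(mem_imset _ _ (@perm_inj _ f)) -in_setD AB set11.
(* If [t] is in [alpha], then [phi] exchanges [A] and [B]. This reverses their difference, and so
   does complementation, whence the exclusive or with [b]. *)
have BSE : symdiff (val B) S = val A by rewrite BE symdiffK.
rewrite !fP !val_phi // pA pB -BE BSE.
have CD (X Y : {set G}) : ~: X :\: ~: Y = Y :\: X by rewrite !setDE setCK setIC.
by case: b {fP}; case: (t \in alpha) => /=; rewrite ?CD ?AB ?BA => /set1P.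
Qed.

(** With the same [b] for both classes, [t] and [t'] would force [f x] to be both [x] and [y]. *)
Lemma mixed_not_induced alpha t t' : alpha \subset profiles k C ->
  t \in alpha -> t' \in profiles k C -> t' \notin alpha ->
  ~ induced_automorphism (phi (k := k) C S alpha).
Proof.
move=> sub_alpha t_in t'_prof t'_out [_ [f _ fP]].
have [b fb] : exists b : bool, forall A, f @: val A
    = if b then ~: val (phi C S alpha A) else val (phi C S alpha A).
  (* In the second case [phi] is the complement of the image under [f], so complementing once more
     isolates that image. *)
  case: fP => [fP|[nk fP]]; [exists false | exists true] => A; rewrite fP //=.
  by rewrite setCK.
have := swapped_of_perm sub_alpha fb (subsetP sub_alpha _ t_in).
rewrite (swapped_of_perm sub_alpha fb t'_prof) t_in (negPf t'_out).
by case: b {fb} => /= /eqP; rewrite ?(eq_sym y) (negPf neq_xy).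
Qed.

Lemma phi0_induced : induced_automorphism (phi (k := k) C S set0).
Proof.
split; first by apply: phi_automorphism; rewrite sub0set.
exists 1%g; first by apply: involutive_automorphism => [u|u v]; rewrite !perm1.
left=> A; apply: val_inj; rewrite val_phi ?sub0set // inE /=.
by rewrite (eq_imset _ (@perm1 _)) imset_id.
Qed.

Lemma phi_profiles_induced :
  induced_automorphism (phi (k := k) C S (profiles k C)).
Proof.
split; first exact: phi_automorphism.
exists (tperm x y); first exact: tperm_twins_automorphism.
by left=> A; apply: val_inj; rewrite val_phi // profiles_profile_of /= tperm_imset.
Qed.

End Swap.

Theorem proposition3 (G : sgraph) (k : nat) (x y : G)
    (c : nat) (C : 'I_c -> {set G}) (alpha : {set profile G c}) :
  connected G -> 1 <= k <= #|G| - 1 ->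
  two_cut_same_neighbours x y ->
  component_listing (~: [set x; y]) C ->
  alpha \subset profiles k C ->
  automorphism (@phi G k c C [set x; y] alpha) /\
  (induced_automorphism (@phi G k c C [set x; y] alpha) <->
     alpha = set0 \/ alpha = profiles k C).
Proof.
move=> _ _ [neq_xy _ twins] listC sub_alpha.
split; first exact: phi_automorphism.
split=> [ind|[->|->]]; last 2 first.
- exact: phi0_induced.
- exact: phi_profiles_induced.
(* A nonempty [alpha] supplies a swapped class [t], so a profile [t'] outside [alpha] would
   contradict inducedness. *)
have [->|[t t_in]] := set_0Vmem alpha; [by left | right].
apply/eqP; rewrite eqEsubset sub_alpha; apply/subsetP=> t' t'_prof.
by apply: contraPT ind => t'_out; apply: mixed_not_induced t_in t'_prof t'_out.
Qed.
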